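(* Let $\Gamma$ be a finite simple graph, and let $P$ be a locally finite poset equipped with a surjective coloring function $\kappa:P\to\Gamma$. Let $\mathcal{FI}(P)$ be the lattice of filter-ideal splits of $P$. (a) The following are equivalent: (i) The lattice $\mathcal{FI}(P)$ carries an upper (respectively lower) $P$-minuscule representation of $\mathfrak{b}'_+$ (respectively $\mathfrak{b}'_-$). (ii) The poset $P$ satisfies EC, NA, AC, I2A, and Mx1GA (respectively Mn1LA). (b) If Condition (ii) is satisfied, then the $\mu$-diagonal operators $\{M_a\}_{a\in\Gamma}$ can be used to give the actions of the $\{h_a\}_{a\in\Gamma}$ for the upper (respectively lower) $P$-minuscule representation of $\mathfrak{b}'_+$ (respectively $\mathfrak{b}'_-$) of (i).
   Context: Graph and poset. $\Gamma$ has no loops or multiple edges; its vertex set is also denoted $\Gamma$ and its vertices are called colors. For $a,b\in\Gamma$, $a\sim b$ means $\{a,b\}$ is an edge (adjacent); $a,b$ are distant if $a\ne b$ and $\{a,b\}$ is not an edge. Put $\theta_{ab}=2$ if $a=b$, $\theta_{ab}=-1$ if $a\sim b$, $\theta_{ab}=0$ if $a,b$ are distant. Locally finite means every closed interval of $P$ is finite. $P_a:=\kappa^{-1}(a)$. $x\to y$ means $x$ is covered by $y$; $x,y$ are neighbors if $x\to y$ or $y\to x$. A filter is an upwardly closed subset, an ideal a downwardly closed subset. A split is a pair $(F,I)$ with $F$ a filter and $I=P-F$; $\mathcal{FI}(P)$ is the set of all splits, ordered by inclusion of ideals. Write $(F-x,I+x)$ for $(F\setminus\{x\},I\cup\{x\})$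 and $(F+y,I-y)$ for $(F\cup\{y\},I\setminus\{y\})$. Operators. $V=\langle\mathcal{FI}(P)\rangle$ is the free complex vector space with basis $\{\langle F,I\rangle\}_{(F,I)\in\mathcal{FI}(P)}$. For $a\in\Gamma$ define linearly $X_a.\langle F,I\rangle=\sum\langle F-x,I+x\rangle$, summed over the elements $x$ of color $a$ minimal in $F$, and $Y_a.\langle F,I\rangle=\sum\langle F+y,I-y\rangle$, summed over the elements $y$ of color $a$ maximal in $I$. Any assertion about these operators is understood to include that the defining sums are finite, so that the operators are well defined. (Finiteness is automatic when EC holds.) $X$-square (respectively $Y$-square) nilpotent means $X_a^2=0$ (respectively $Y_a^2=0$) for all $a$. Lie algebras. $\mathfrak{b}'_+$ is the complex Lie algebra generated by $\{x_a,h_a\}_{a\in\Gamma}$ subject to XX: $[x_b,x_a]=0$ for $a,b$ distant, $[x_a,[x_a,x_b]]=0$ for all $a,b$; HH: $[h_b,h_a]=0$; HX: $[h_b,x_a]=\theta_{ab}x_a$. $\mathfrak{b}'_-$ is generated by $\{y_a,h_a\}_{a\in\Gamma}$ subject to YY: $[y_b,y_a]=0$ for $a,b$ distant, $[y_a,[y_a,y_b]]=0$ for all $a,b$; HH; HY: $[h_b,y_a]=-\theta_{ab}y_a$. Representations. $\mathcal{FI}(P)$ carries a representation of $\mathfrak{b}'_+$ (respectively $\mathfrak{b}'_-$) if there are operators $\{H_a\}_{a\in\Gamma}$ on $V$, diagonal in the basis $\{\langle F,I\rangle\}$, such that the $X_a$ (respectively $Y_a$) and $H_a$, giving the actions of $x_a$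 (respectively $y_a$) and $h_a$, satisfy the defining relations with respect to the commutator on $\mathrm{End}(V)$. The eigenvalue set of $\{H_a\}$ is the set of all eigenvalues of $H_a$ on basis vectors, over all $a$ and all splits. A representation of $\mathfrak{b}'_+$ (respectively $\mathfrak{b}'_-$) carried by $\mathcal{FI}(P)$ is upper (respectively lower) $P$-minuscule if it is $X$-square (respectively $Y$-square) nilpotent, the eigenvalue set of $\{H_a\}$ is contained in $\{-1,0,1,2,\dots\}$ (respectively $\{\dots,-2,-1,0,1\}$), and for every split $(F,I)$ and $a\in\Gamma$: $H_a.\langle F,I\rangle=-\langle F,I\rangle$ (respectively $+\langle F,I\rangle$) if and only if $F$ has a minimal element (respectively $I$ has a maximal element) of color $a$. Coloring properties. EC: elements with equal colors are comparable. NA: neighbors have adjacent colors. AC: elements with adjacent colors are comparable. I2A: for every $a\in\Gamma$, the open interval between any two consecutive elements of color $a$ (i.e. $x<y$ in $P_a$ with no element of $P_a$ strictly between) contains exactly two elements whose colors are adjacent to $a$. Mx1GA: for every $a$, if $x$ is maximal in $P_a$, then at most one element greater than $x$ has color adjacent to $a$. Mn1LA: for every $a$, if $x$ is minimal in $P_a$, then at most one element less than $x$ has color adjacent to $a$. The $\mu$-diagonal operators (defined when $P$ satisfies EC). Fix $b\in\Gamma$ and a split $(F,I)$. Define $\upsilon_b(F,I)$: if $P_b\cap I$ has no maximal element, $\upsilon_b(F,I):=1$. Otherwise let $y$ be its (unique) maximal element and let $\Upsilon_b(F,I)$ be the set of $z\in I$ with $z>y$, $c:=\kappa(z)\sim b$,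 and only finitely many elements of $P_c\cap I$ greater than $y$; put $\upsilon_b(F,I):=|\Upsilon_b(F,I)|+1$ if some color $a\sim b$ has infinitely many elements of $P_a\cap I$ greater than $y$, and $\upsilon_b(F,I):=|\Upsilon_b(F,I)|$ otherwise. Dually define $\psi_b(F,I)$: if $P_b\cap F$ has no minimal element, $\psi_b(F,I):=1$. Otherwise let $y$ be its (unique) minimal element and let $\Psi_b(F,I)$ be the set of $z\in F$ with $z<y$, $c:=\kappa(z)\sim b$, and only finitely many elements of $P_c\cap F$ less than $y$; put $\psi_b(F,I):=|\Psi_b(F,I)|+1$ if some $a\sim b$ has infinitely many elements of $P_a\cap F$ less than $y$, and $\psi_b(F,I):=|\Psi_b(F,I)|$ otherwise. Set $\mu_b(F,I):=1-\upsilon_b(F,I)$ if $P_b\cap I\neq\emptyset$ and $\mu_b(F,I):=-1+\psi_b(F,I)$ if $P_b\cap I=\emptyset$. The $\mu$-diagonal operators are given by $M_a.\langle F,I\rangle=\mu_a(F,I)\langle F,I\rangle$. *)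

(* Defs.v *)
From HB Require Import structures.
From mathcomp Require Import all_boot all_order all_algebra.
From mathcomp Require Import finmap.
From mathcomp.multinomials Require Import monalg.
From mathcomp Require Import complex.
From mathcomp Require Import boolp classical_sets functions cardinality fsbigop.
From mathcomp Require Import reals.

Set Implicit Arguments.
Unset Strict Implicit.
Unset Printing Implicit Defensive.

Import Order.TTheory GRing.Theory Num.Theory.

Local Open Scope classical_set_scope.
Local Open Scope ring_scope.

(* Finite simple graphs; the vertices are the colors. *)
Record sgraph := SGraph {
  color :> finType;
  adj : rel color;
  adj_sym : symmetric adj;
  adj_irrefl : irreflexive adj
}.

Definition distant (G : sgraph) (a b : G) : bool := (a != b) && ~~ adj a b.

Definition theta (G : sgraph) (a b : G) : int :=
  if a == b then 2 else if adj a b then -1 else 0.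

Definition locally_finite_poset d (P : porderType d) := forall x y : P,
  finite_set [set z | (x <= z <= y)%O].

Section Posets.
Context {d : Order.disp_t} {P : porderType d}.
Implicit Types (A : set P) (x y z : P).

Definition minimal_in A x := A x /\ forall y, A y -> ~~ (y < x)%O.
Definition maximal_in A x := A x /\ forall y, A y -> ~~ (x < y)%O.

Definition covered_by x y := (x < y)%O /\ forall z, ~~ (x < z < y)%O.
Definition neighbors x y := covered_by x y \/ covered_by y x.

Definition is_filter A := forall x y, A x -> (x <= y)%O -> A y.
Definition is_ideal A := forall x y, A y -> (x <= y)%O -> A x.

End Posets.

Section Splits.
Context {d : Order.disp_t} (P : porderType d).

(* A split (F, I) is a filter F together with its complement I = P - F. *)
Record fisplit := FISplit {
  filt : set P;
  idl : set P;
  filtP : is_filter filt;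
  idlE : idl = ~` filt
}.

HB.instance Definition _ := gen_eqMixin fisplit.
HB.instance Definition _ := gen_choiceMixin fisplit.

Implicit Types (s t : fisplit) (x y : P).

Lemma fisplit_eq s t : filt s = filt t -> s = t.
Proof.
case: s => F I hF hI; case: t => F' I' hF' hI' /= eF; subst.
by congr FISplit; exact: Prop_irrelevance.
Qed.

Lemma idl_ideal s : is_ideal (idl s).
Proof. by move=> x y; rewrite idlE /= => Iy xy Fx; apply: Iy; apply: filtP xy. Qed.

Lemma filt_del s x : minimal_in (filt s) x -> is_filter (filt s `\ x).
Proof.
move=> [_ xmin] y z [Fy yx] yz; split; first exact: filtP yz.
move=> /= zx; have := xmin _ Fy; rewrite -zx lt_neqAle yz andbT negbK => /eqP.
by rewrite zx.
Qed.

Lemma idl_add s x : minimal_in (filt s) x -> idl s `|` [set x] = ~` (filt s `\ x).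
Proof. by move=> _; rewrite setCD idlE. Qed.

Lemma filt_add s y : maximal_in (idl s) y -> is_filter (filt s `|` [set y]).
Proof.
move=> [Iy ymax] u v [Fu|->] uv; first by left; apply: filtP uv.
have [->|vy] := eqVneq v y; first by right.
left; apply: contrapT => nFv.
have Iv : idl s v by rewrite idlE.
by have := ymax _ Iv; rewrite lt_neqAle eq_sym vy uv.
Qed.

Lemma idl_del s y : maximal_in (idl s) y -> idl s `\ y = ~` (filt s `|` [set y]).
Proof. by move=> _; rewrite setCU idlE. Qed.

(* (F - x, I + x), with the junk value (F, I) if x is not minimal in F *)
Definition to_ideal s x : fisplit :=
  match pselect (minimal_in (filt s) x) with
  | left h => FISplit (filt_del h) (idl_add h)
  | right _ => s
  end.

(* (F + y, I - y), with the junk value (F, I) if y is not maximal in I *)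
Definition to_filter s y : fisplit :=
  match pselect (maximal_in (idl s) y) with
  | left h => FISplit (filt_add h) (idl_del h)
  | right _ => s
  end.

End Splits.

Arguments filt {d P}.
Arguments idl {d P}.

Section LinearExtension.
Context (K : nzRingType) (B : choiceType) (W : lmodType K) (f : B -> W).

Definition linext (v : {malg K[B]}) : W := \sum_(s <- msupp v) v@_s *: f s.

Lemma linextw (D : {fset B}) v : (msupp v `<=` D)%fset ->
  linext v = \sum_(s <- D) v@_s *: f s.
Proof.
move=> sD; apply: big_fset_incl => // s _ /mcoeff_outdom ->.
by rewrite scale0r.
Qed.

Lemma linext_linear : linear linext.
Proof.
move=> c u v; pose D := (msupp (c *: u + v) `|` (msupp u `|` msupp v))%fset.
have sD : (msupp (c *: u + v) `<=` D)%fset by rewrite fsubsetUl.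
have sDu : (msupp u `<=` D)%fset.
  by rewrite (fsubset_trans _ (fsubsetUr _ _)) ?fsubsetUl.
have sDv : (msupp v `<=` D)%fset.
  by rewrite (fsubset_trans _ (fsubsetUr _ _)) ?fsubsetUr.
rewrite (linextw sD) (linextw sDu) (linextw sDv).
rewrite scaler_sumr -big_split /=; apply: eq_bigr => s _.
by rewrite mcoeffD mcoeffZ scalerDl scalerA.
Qed.

HB.instance Definition _ :=
  GRing.isLinear.Build K {malg K[B]} W *:%R linext linext_linear.

End LinearExtension.

Section Representations.
Context (R : realType) {G : sgraph} {d : Order.disp_t} {P : porderType d}.
Context (kappa : P -> G).
Implicit Types (a b c : G) (s : fisplit P).

Definition V := {malg R[i][fisplit P]}.

Definition ket s : V := << s >>.

(* Commutator on End(V) *)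
Definition bracket (f g : V -> V) : V -> V := fun v => f (g v) - g (f v).

Definition min_of_color a s : set P :=
  [set x | minimal_in (filt s) x /\ kappa x = a].
Definition max_of_color a s : set P :=
  [set y | maximal_in (idl s) y /\ kappa y = a].

(* The sums defining the operators are finite; the operators below take the
   junk value 0 on basis vectors where this fails. *)
Definition X_defined := forall a s, finite_set (min_of_color a s).
Definition Y_defined := forall a s, finite_set (max_of_color a s).

Definition Xop a : {linear V -> V} :=
  linext (fun s => \sum_(x \in min_of_color a s) ket (to_ideal s x)).
Definition Yop a : {linear V -> V} :=
  linext (fun s => \sum_(y \in max_of_color a s) ket (to_filter s y)).

Definition diagonal_op (f : V -> V) := forall s,
  exists c : R[i], f (ket s) = c *: ket s.

Definition rel_HH (h : G -> V -> V) := forall a b v, bracket (h b) (h a) v = 0.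

(* Also used for the relations YY. *)
Definition rel_XX (x : G -> V -> V) :=
  (forall a b, distant a b -> forall v, bracket (x b) (x a) v = 0) /\
  (forall a b v, bracket (x a) (bracket (x a) (x b)) v = 0).

Definition rel_HX (x h : G -> V -> V) := forall a b v,
  bracket (h b) (x a) v = (theta a b)%:~R *: x a v.
Definition rel_HY (y h : G -> V -> V) := forall a b v,
  bracket (h b) (y a) v = - (theta a b)%:~R *: y a v.

Definition bplus_relations (x h : G -> V -> V) :=
  [/\ rel_XX x, rel_HH h & rel_HX x h].
Definition bminus_relations (y h : G -> V -> V) :=
  [/\ rel_XX y, rel_HH h & rel_HY y h].

Definition bplus_representation (H : G -> {linear V -> V}) :=
  [/\ X_defined, forall a, diagonal_op (H a) & bplus_relations Xop H].
Definition bminus_representation (H : G -> {linear V -> V}) :=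
  [/\ Y_defined, forall a, diagonal_op (H a) & bminus_relations Yop H].

Definition square_nilpotent (f : G -> V -> V) := forall a v, f a (f a v) = 0.

Definition eigenvalue_set (H : G -> V -> V) : set R[i] :=
  [set c | exists a s, H a (ket s) = c *: ket s].

Definition upper_minuscule (H : G -> {linear V -> V}) :=
  [/\ bplus_representation H,
      square_nilpotent Xop,
      eigenvalue_set H `<=` [set m%:~R | m in [set m : int | -1 <= m]] &
      forall s a, H a (ket s) = - ket s <-> min_of_color a s !=set0].

Definition lower_minuscule (H : G -> {linear V -> V}) :=
  [/\ bminus_representation H,
      square_nilpotent Yop,
      eigenvalue_set H `<=` [set m%:~R | m in [set m : int | m <= 1]] &
      forall s a, H a (ket s) = ket s <-> max_of_color a s !=set0].

End Representations.

Section Coloring.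
Context {G : sgraph} {d : Order.disp_t} {P : porderType d} (kappa : P -> G).
Implicit Types (a b c : G) (x y z : P) (s : fisplit P).

Definition Pcol a : set P := [set x | kappa x = a].

Definition prop_EC := forall x y, kappa x = kappa y -> (x >=< y)%O.
Definition prop_NA := forall x y, neighbors x y -> adj (kappa x) (kappa y).
Definition prop_AC := forall x y, adj (kappa x) (kappa y) -> (x >=< y)%O.

Definition consecutive a x y :=
  [/\ Pcol a x, Pcol a y, (x < y)%O & forall z, Pcol a z -> ~~ (x < z < y)%O].

Definition prop_I2A := forall a x y, consecutive a x y ->
  ([set z | (x < z < y)%O /\ adj (kappa z) a] #= `I_2)%card.

Definition prop_Mx1GA := forall a x, maximal_in (Pcol a) x ->
  is_subset1 [set z | (x < z)%O /\ adj (kappa z) a].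
Definition prop_Mn1LA := forall a x, minimal_in (Pcol a) x ->
  is_subset1 [set z | (z < x)%O /\ adj (kappa z) a].

Definition Iabove s y c : set P := [set z | [/\ Pcol c z, idl s z & (y < z)%O]].
Definition Fbelow s y c : set P := [set z | [/\ Pcol c z, filt s z & (z < y)%O]].

Definition Upsilon b s y : set P :=
  [set z | [/\ idl s z, (y < z)%O, adj (kappa z) b &
               finite_set (Iabove s y (kappa z))]].
Definition Psi b s y : set P :=
  [set z | [/\ filt s z, (z < y)%O, adj (kappa z) b &
               finite_set (Fbelow s y (kappa z))]].

(* The sets Upsilon and Psi are finite because G is; the element y chosen by
   cid is unique under EC, the only case in which these definitions matter. *)
Definition upsilon b s : nat :=
  match pselect (exists y, maximal_in (Pcol b `&` idl s) y) with
  | left h => let y := projT1 (cid h) in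
      (#|` fset_set (Upsilon b s y)| +
       `[< exists a, adj a b /\ infinite_set (Iabove s y a) >])%N
  | right _ => 1%N
  end.

Definition psi b s : nat :=
  match pselect (exists y, minimal_in (Pcol b `&` filt s) y) with
  | left h => let y := projT1 (cid h) in
      (#|` fset_set (Psi b s y)| +
       `[< exists a, adj a b /\ infinite_set (Fbelow s y a) >])%N
  | right _ => 1%N
  end.

Definition mu b s : int :=
  if `[< Pcol b `&` idl s !=set0 >] then 1 - (upsilon b s)%:Z
  else -1 + (psi b s)%:Z.

Definition mu_op (R : realType) a : {linear V R (P := P) -> V R} :=
  linext (fun s => (mu a s)%:~R *: ket R s).

End Coloring.

(* Main.v *)
Require Import Defs.
From HB Require Import structures.
From mathcomp Require Import all_boot all_order all_algebra.
From mathcomp Require Import finmap.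
From mathcomp.multinomials Require Import monalg.
From mathcomp Require Import complex.
From mathcomp Require Import boolp classical_sets functions cardinality fsbigop.
From mathcomp Require Import reals.

(** Everything that the relations of the Borel subalgebras say about a
diagonal family [H] can be read off from its eigenvalues.  Write [c a s] for
the eigenvalue of [H a] on the split [s]; for the lower case take the negative
of the eigenvalue.  Then a minuscule representation is the same as a _weight_
([move_weight]): an integer function with [c a s >= -1], with [c a s = -1]
exactly when an element of color [a] can be moved, and such that moving an
element of color [a] adds [theta a b] to [c b].

These three rules force all relations between the operators.  After a move of
color [a] the weight [c a] is [-1 + 2 = 1], so no second element of color [a]
can be moved; hence there is at most one movable element of each color and
[X_a ^ 2 = 0].  After moves of colors [a] and [b ~ a] the weight [c a] is [0],
so [X_a X_b X_a = 0], and the Serre relation follows.  If [a] and [b] are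
distant, moving [a] does not change [c b], so it neither creates nor destroys a
movable element of color [b], and the two moves commute.  Conversely the
relation between [H_b] and [X_a], compared on one basis vector of the image,
is the third rule ([weight_representation], [relations_weight]).

It remains to compare weights with the coloring properties.

Given an upper weight, each property comes from moving the elements of a finite
set out of a filter generated by one or two elements and following the
weight.  Two incomparable elements are both minimal in the filter that they
generate; equal colors contradict uniqueness of the movable element (EC), and
adjacent colors give the weight [-2] after one move (AC).  For consecutive
[x < y] of color [a], moving the half-open interval from [x] to [y] leads from
weight [-1] to weight [-1] through [+2] for [x] and [-1] for each element of
adjacent color, so there are two of the latter (I2A).  If [x] is the last
element of color [a], two elements of adjacent color above [x] would produce
weight [-1] with no element of color [a] left (Mx1GA).  A lower weight is an
upper weight of the dual poset, which gives the lower case.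

Given the properties, [mu] is an upper weight and [- mu] a lower weight.
As long as the ideal contains elements of color [b], [mu b] is read off from
the elements of colors adjacent to [b] in the ideal above the last element of
color [b]; otherwise from those in the filter below the first element of color
[b].  Moving an element of adjacent color changes the count by one
([mu_to_ideal]).  The count vanishes exactly when the nearest element of color
[b] is itself movable, because by NA an obstacle would be an element of
adjacent color ([upsilon_eq0], [psi_eq0]).  Up to the next element of color
[b] the count is at most [2] by I2A, with equality exactly when this next
element is movable; if there is no next element, Mx1GA or Mn1LA bounds the
count by [1]. *)

Set Implicit Arguments.
Unset Strict Implicit.
Unset Printing Implicit Defensive.

Import Order.TTheory GRing.Theory Num.Theory.

Local Open Scope classical_set_scope.
Local Open Scope ring_scope.

(** * Weights of a system of colored moves *)

(** In a state [s], the elements of [step a s] are those of color [a] that can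
be moved, and [act s x] is the state after moving [x].  The sign convention is
the one of the upper case; lower representations use the opposite weight. *)
Definition move_weight (G : sgraph) (T S : Type) (step : G -> S -> set T)
    (act : S -> T -> S) (c : G -> S -> int) :=
  [/\ forall a s, -1 <= c a s,
      forall a s, c a s = -1 <-> step a s !=set0 &
      forall a b s x, step a s x -> c b (act s x) = c b s + theta a b].

(** The moves and the module are kept abstract because the operators [X] and [Y]
obey the same argument.  The [coord] are the coordinate forms of the basis
[ket]; [eq_on_kets] says that the basis generates. *)
Section Moves.
Context (K : numDomainType) (W : lmodType K) (S : choiceType) (ket : S -> W).
Context (coord : S -> {scalar W}).
Hypothesis coord_ket : forall s t, coord t (ket s) = (s == t)%:R.
Hypothesis eq_on_kets : forall f g : {linear W -> W},
  (forall s, f (ket s) = g (ket s)) -> f =1 g.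
Context (G : sgraph) (T : choiceType) (kappa : T -> G).
Context (step : G -> S -> set T) (act : S -> T -> S).
Implicit Types (a b : G) (s : S) (c : G -> S -> int).
Implicit Types (e : int) (H : G -> {linear W -> W}).

Hypothesis step_color : forall a s x, step a s x -> kappa x = a.
Hypothesis act_faithful : forall a s x y,
  step a s x -> step a s y -> act s x = act s y -> x = y.
Hypothesis step_diamond : forall a b s x y,
  step a s x -> step b s y -> x <> y ->
  step b (act s x) y /\ act (act s x) y = act (act s y) x.

Context (X : G -> {linear W -> W}).
Hypothesis X_ket : forall a s,
  X a (ket s) = \sum_(x \in step a s) ket (act s x).

(** The sign [e] is [1] for upper and [-1] for lower representations. *)
Definition weight_op (e : int) c (H : G -> {linear W -> W}) :=
  forall a s, H a (ket s) = (e * c a s)%:~R *: ket s.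

Definition rel_HM (e : int) (H : G -> {linear W -> W}) := forall a b v,
  H b (X a v) - X a (H b v) = (e * theta a b)%:~R *: X a v.

Lemma theta_diag a : theta a a = 2.
Proof. by rewrite /theta eqxx. Qed.

Lemma X_ket0 a s : step a s = set0 -> X a (ket s) = 0.
Proof. by move=> s0; rewrite X_ket s0 fsbig_set0. Qed.

Section WeightToRelations.
Context (c : G -> S -> int) (e : int) (H : G -> {linear W -> W}).
Hypotheses (cP : move_weight step act c) (HE : weight_op e c H).

Let weight_eqN1 a s : c a s = -1 <-> step a s !=set0.
Proof. by case: cP. Qed.

Let weight_act a b s x : step a s x -> c b (act s x) = c b s + theta a b.
Proof. by case: cP => _ _; apply. Qed.

Lemma step_empty a s : c a s <> -1 -> step a s = set0.
Proof.
move=> ca; apply: contrapT => /eqP/set0P ne; apply: ca.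
exact/weight_eqN1.
Qed.

Lemma weight_at_step a s x : step a s x -> c a s = -1.
Proof. by move=> sx; apply/weight_eqN1; exists x. Qed.

Lemma weight_same_color a s x : step a s x -> c a (act s x) = 1.
Proof.
by move=> sx; rewrite (weight_act _ sx) (weight_at_step sx) theta_diag.
Qed.

(** If two elements of color [a] could be moved, the second could still be moved
after the first, although the weight has then become [1]. *)
Lemma step_uniq a s x y : step a s x -> step a s y -> x = y.
Proof.
move=> sx sy; apply: contrapT => xy.
have [/weight_at_step + _] := step_diamond sx sy xy.
by rewrite (weight_same_color sx).
Qed.

Lemma X_step a s x : step a s x -> X a (ket s) = ket (act s x).
Proof.
move=> sx; rewrite X_ket.
suff -> : step a s = [set x] by rewrite fsbig_set1.
by apply/seteqP; split=> [y sy|y ->//]; exact: step_uniq sy sx.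
Qed.

Lemma X_ketP a s :
  (exists2 x, step a s x & X a (ket s) = ket (act s x)) \/
  (step a s = set0 /\ X a (ket s) = 0).
Proof.
have [[x sx]|ne] := pselect (step a s !=set0).
  by left; exists x => //; exact: X_step.
have s0 : step a s = set0 by apply: contrapT => /eqP/set0P.
by right; rewrite X_ket0.
Qed.

Lemma step_finite a s : finite_set (step a s).
Proof.
have [[x sx]|ne] := pselect (step a s !=set0); last first.
  by rewrite (_ : step a s = set0) //; apply: contrapT => /eqP/set0P.
suff -> : step a s = [set x] by exact: finite_set1.
by apply/seteqP; split=> [y sy|y ->//]; exact: step_uniq sy sx.
Qed.

Lemma X_square0 a v : X a (X a v) = 0.
Proof.
move: v; apply: (eq_on_kets (f := X a \o X a) (g := \0)) => s /=.
have [[x sx ->]|[_ ->]] := X_ketP a s; last by rewrite linear0.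
by rewrite X_ket0 //; apply: step_empty; rewrite weight_same_color.
Qed.

(** The weight of color [a] runs through [-1], [1], [0], which excludes a second
move of color [a]. *)
Lemma X_aba0 a b v : adj a b ->
  X a (X b (X a v)) = 0.
Proof.
move=> ab; move: v.
apply: (eq_on_kets (f := X a \o (X b \o X a)) (g := \0)).
move=> s /=.
have [[x sx ->]|[_ ->]] := X_ketP a s; last by rewrite !linear0.
have [[y sy ->]|[_ ->]] := X_ketP b (act s x); last by rewrite linear0.
rewrite X_ket0 //; apply: step_empty.
rewrite (weight_act _ sy) (weight_same_color sx) /theta adj_sym ab.
by case: eqP ab => // ->; rewrite adj_irrefl.
Qed.

(** A movable element of color [b] that is seen after a move of a distant color
was already movable before: [c b] has not changed, so some element of color
[b] was movable, it stays so by the diamond property, and uniqueness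
identifies the two. *)
Lemma distant_step a b s x y : distant a b -> step a s x ->
  step b (act s x) y ->
  [/\ step b s y, step a (act s y) x & act (act s x) y = act (act s y) x].
Proof.
move=> /andP[ab nab] sx sy.
have [y' sy'] : step b s !=set0.
  apply/weight_eqN1; have := weight_at_step sy.
  by rewrite (weight_act _ sx) /theta (negPf ab) (negPf nab) addr0.
have xy' : x <> y'.
  by move=> xy; case/eqP: ab; rewrite -(step_color sx) xy (step_color sy').
have [sy2 e1] := step_diamond sx sy' xy'.
have yy' := step_uniq sy sy2; rewrite {y sy}yy'; split=> //.
by case: (step_diamond sy' sx) => // yx; case: xy'.
Qed.

Lemma distantC a b : distant a b = distant b a.
Proof. by rewrite /distant eq_sym adj_sym. Qed.

Lemma X_commute a b v : distant a b ->
  X b (X a v) = X a (X b v).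
Proof.
move=> ab; move: v.
apply: (eq_on_kets (f := X b \o X a) (g := X a \o X b)).
move=> s /=; have [[x sx e1]|[na ea]] := X_ketP a s.
  have [[y sy e2]|[nb eb]] := X_ketP b (act s x).
    have [sy' sx' e3] := distant_step ab sx sy.
    by rewrite e1 e2 (X_step sy') (X_step sx') e3.
  rewrite e1 eb; have [[z sz ->]|[_ ->]] := X_ketP b s; last by rewrite linear0.
  have [[y sy _]|[_ ->//]] := X_ketP a (act s z).
  rewrite distantC in ab; have [sy' sz' _] := distant_step ab sz sy.
  by rewrite (step_uniq sy' sx) nb in sz'.
rewrite ea linear0; have [[z sz ->]|[_ ->]] := X_ketP b s; last by rewrite linear0.
have [[y sy _]|[_ ->//]] := X_ketP a (act s z).
by rewrite distantC in ab; have [+ _ _] := distant_step ab sz sy; rewrite na.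
Qed.

(** With [X a] square zero the left hand side is [- 2 X_a X_b X_a]. *)
Lemma X_serre a b v :
  X a (X a (X b v) - X b (X a v)) - (X a (X b (X a v)) - X b (X a (X a v))) = 0.
Proof.
have [<-|ab] := eqVneq a b; first by rewrite !subrr linear0 subrr.
have [aab|nab] := boolP (adj a b); last first.
  have dab : distant a b by rewrite /distant ab.
  by rewrite !(X_commute _ dab) !subrr linear0 subrr.
by rewrite linearB /= !X_aba0 // !X_square0 !(linear0, addr0).
Qed.

Lemma weight_op_comm a b v : H b (H a v) - H a (H b v) = 0.
Proof.
apply/eqP; rewrite subr_eq0; apply/eqP; move: v.
apply: (eq_on_kets (f := H b \o H a) (g := H a \o H b)) => s /=.
by rewrite !HE !linearZ /= !HE !scalerA mulrC.
Qed.

Lemma weight_rel_HM : rel_HM e H.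
Proof.
move=> a b.
apply: (eq_on_kets (f := (H b \o X a) \- (X a \o H b))
                   (g := _ \*: X a)) => s /=.
rewrite HE linearZ /=.
have [[x sx ->]|[_ ->]] := X_ketP a s; last by rewrite linear0 !scaler0 subrr.
by rewrite HE (weight_act _ sx) -scalerBl -rmorphB /= -mulrBr addrAC subrr add0r.
Qed.

Lemma weight_representation :
  [/\ forall a s, finite_set (step a s),
      (forall a b, distant a b -> forall v, X b (X a v) - X a (X b v) = 0) /\
      (forall a b v, X a (X a (X b v) - X b (X a v)) -
                     (X a (X b (X a v)) - X b (X a (X a v))) = 0),
      forall a b v, H b (H a v) - H a (H b v) = 0,
      rel_HM e H &
      forall a v, X a (X a v) = 0].
Proof.
split; [exact: step_finite|split|exact: weight_op_comm|exact: weight_rel_HM|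
  exact: X_square0].
  by move=> a b ab v; rewrite (X_commute v ab) subrr.
exact: X_serre.
Qed.

End WeightToRelations.

Lemma weight_op_eqN1 e c H a s : e != 0 -> weight_op e c H ->
  H a (ket s) = (- e)%:~R *: ket s <-> c a s = -1.
Proof.
move=> e0 HE; split=> [|ca]; last by rewrite HE ca mulrN1.
rewrite HE => /(congr1 (coord s)).
rewrite !linearZ /= coord_ket eqxx !mulr1 => /intr_inj ce.
by apply: (mulfI e0); rewrite ce mulrN1.
Qed.

(** Distinct moves from [s] lead to distinct basis vectors, so the relation can be
compared on the coordinate of [act s x] alone. *)
Lemma rel_HM_weight_act e c H : e != 0 ->
  (forall a s, finite_set (step a s)) -> weight_op e c H -> rel_HM e H ->
  forall a b s x, step a s x -> c b (act s x) = c b s + theta a b.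
Proof.
move=> e0 fin HE HM a b s x sx.
have := HM a b (ket s); rewrite HE linearZ /=.
have -> : X a (ket s) = \sum_(y <- fset_set (step a s)) ket (act s y).
  by rewrite X_ket fsbig_finite.
have coefx (f : T -> K) :
    coord (act s x) (\sum_(y <- fset_set (step a s)) f y *: ket (act s y)) = f x.
  rewrite raddf_sum (big_fsetD1 x) /= ?in_fset_set ?inE //.
  rewrite linearZ /= coord_ket eqxx mulr1 big1_fset ?addr0 // => y.
  rewrite in_fsetD1 in_fset_set // => /andP[/eqP yx /set_mem sy] _.
  rewrite linearZ /= coord_ket; case: eqP => [eyx|]; last by rewrite mulr0.
  by case: yx; apply: act_faithful sy sx eyx.
move/(congr1 (coord (act s x))).
rewrite linear_sum !scaler_sumr linearB /=.
under eq_bigr => y _ do rewrite HE.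
rewrite (coefx (fun y => (e * c b (act s y))%:~R)).
rewrite (coefx (fun=> (e * c b s)%:~R)) (coefx (fun=> (e * theta a b)%:~R)).
rewrite -rmorphB => /intr_inj; rewrite -mulrBr => /(mulfI e0) <-.
by rewrite addrCA subrr addr0.
Qed.

Lemma relations_weight e H : e != 0 ->
  (forall a s, finite_set (step a s)) ->
  (forall a s, exists2 m : int, -1 <= m & H a (ket s) = (e * m)%:~R *: ket s) ->
  (forall a s, H a (ket s) = (- e)%:~R *: ket s <-> step a s !=set0) ->
  rel_HM e H ->
  exists c, move_weight step act c.
Proof.
move=> e0 fin eigen HN1 HM; pose c a s := s2val (cid2 (eigen a s)).
have HE : weight_op e c H by move=> a s; rewrite /c; case: cid2.
exists c; split=> [a s|a s|a b s x]; first by rewrite /c; case: cid2.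
  by rewrite -HN1 (weight_op_eqN1 _ _ e0 HE).
exact: rel_HM_weight_act HE HM a b s x.
Qed.

End Moves.

(** * The free vector space on the splits *)

Section FreeModule.
Context (R : realType) (d : Order.disp_t) (P : porderType d).
Local Notation V := (V R (P := P)).

Lemma linext_ket (f : fisplit P -> V) s : linext f (ket R s) = f s.
Proof.
have sD : (msupp (ket R s) `<=` [fset s])%fset.
  by rewrite /ket msuppU oner_eq0 fsubset_refl.
by rewrite (linextw f sD) big_seq_fset1 mcoeffUU scale1r.
Qed.

Lemma eq_on_kets (f g : {linear V -> V}) :
  (forall s, f (ket R s) = g (ket R s)) -> f =1 g.
Proof.
move=> fg v; rewrite [v]monalgE !linear_sum; apply: eq_bigr => s _.
have -> : << v@_s *g s >> = v@_s *: ket R s.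
  by apply/malgP => k; rewrite mcoeffZ !mcoeffU mulrnAr mulr1.
by rewrite !linearZ /= fg.
Qed.

Definition coeff (s : fisplit P) (v : V) : R[i] := v@_s.

Lemma coeff_linear s : linear_for *%R (coeff s).
Proof. by move=> z u v; rewrite /coeff mcoeffD mcoeffZ. Qed.

HB.instance Definition _ s :=
  GRing.isLinear.Build R[i] V R[i] *%R (coeff s) (coeff_linear s).

Lemma coeff_ket s t : coeff t (ket R s) = (s == t)%:R.
Proof. exact: mcoeffU. Qed.

End FreeModule.

(** * Moving one element across a split *)

Section Splits.
Context (G : sgraph) (d : Order.disp_t) (P : porderType d) (kappa : P -> G).
Implicit Types (a b : G) (s : fisplit P) (x y : P).

Lemma filtPn s x : filt s x <-> ~ idl s x.
Proof. by rewrite idlE /=; split=> [? /(_ _)//|/contrapT]. Qed.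

Lemma idl_to_ideal s x : minimal_in (filt s) x ->
  idl (to_ideal s x) = idl s `|` [set x].
Proof. by rewrite /to_ideal; case: pselect. Qed.

Lemma filt_to_ideal s x : minimal_in (filt s) x ->
  filt (to_ideal s x) = filt s `\ x.
Proof. by rewrite /to_ideal; case: pselect. Qed.

Lemma idl_to_filter s x : maximal_in (idl s) x ->
  idl (to_filter s x) = idl s `\ x.
Proof. by rewrite /to_filter; case: pselect. Qed.

Lemma filt_to_filter s x : maximal_in (idl s) x ->
  filt (to_filter s x) = filt s `|` [set x].
Proof. by rewrite /to_filter; case: pselect. Qed.

Lemma min_color a s x : min_of_color kappa a s x -> kappa x = a.
Proof. by case. Qed.

Lemma max_color a s x : max_of_color kappa a s x -> kappa x = a.
Proof. by case. Qed.

Lemma to_ideal_inj a s x y :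
  min_of_color kappa a s x -> min_of_color kappa a s y ->
  to_ideal s x = to_ideal s y -> x = y.
Proof.
move=> [mx _] [my _] /(congr1 idl); rewrite !idl_to_ideal // => /seteqP[+ _].
by move=> /(_ x (or_intror erefl))[|//]; rewrite idlE; case: mx.
Qed.

Lemma to_filter_inj a s x y :
  max_of_color kappa a s x -> max_of_color kappa a s y ->
  to_filter s x = to_filter s y -> x = y.
Proof.
move=> [mx _] [my _] /(congr1 filt); rewrite !filt_to_filter // => /seteqP[+ _].
move=> /(_ x (or_intror erefl))[|//] Fx.
by case: mx => + _; rewrite idlE => /(_ Fx).
Qed.

Lemma minimal_filtD1 s x y :
  minimal_in (filt s) y -> x <> y -> minimal_in (filt s `\ x) y.
Proof. by move=> [Fy ymin] xy; split=> [|z [/ymin]//]; split=> // /esym. Qed.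

Lemma maximal_idlD1 s x y :
  maximal_in (idl s) y -> x <> y -> maximal_in (idl s `\ x) y.
Proof. by move=> [Iy ymax] xy; split=> [|z [/ymax]//]; split=> // /esym. Qed.

Lemma to_ideal_diamond a b s x y :
  min_of_color kappa a s x -> min_of_color kappa b s y -> x <> y ->
  min_of_color kappa b (to_ideal s x) y /\
  to_ideal (to_ideal s x) y = to_ideal (to_ideal s y) x.
Proof.
move=> [mx _] [my ky] xy.
have myx := minimal_filtD1 my xy.
have mxy := minimal_filtD1 mx (nesym xy).
split; first by split=> //; rewrite filt_to_ideal.
apply: fisplit_eq; rewrite !filt_to_ideal //.
by rewrite setDDl setUC -setDDl.
Qed.

Lemma to_filter_diamond a b s x y :
  max_of_color kappa a s x -> max_of_color kappa b s y -> x <> y ->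
  max_of_color kappa b (to_filter s x) y /\
  to_filter (to_filter s x) y = to_filter (to_filter s y) x.
Proof.
move=> [mx _] [my ky] xy.
have myx := maximal_idlD1 my xy.
have mxy := maximal_idlD1 mx (nesym xy).
split; first by split=> //; rewrite idl_to_filter.
apply: fisplit_eq; rewrite !filt_to_filter ?idl_to_filter //.
by rewrite setUAC.
Qed.

End Splits.

(** * Minuscule representations are weights *)

Section Minuscule.
Context (R : realType) (G : sgraph) (d : Order.disp_t) (P : porderType d).
Context (kappa : P -> G).
Local Notation V := (V R (P := P)).
Implicit Types (H : G -> {linear V -> V}) (c : G -> fisplit P -> int).

Definition upper_weight := move_weight (min_of_color kappa) (to_ideal (P := P)).
Definition lower_weight := move_weight (max_of_color kappa) (to_filter (P := P)).

Lemma Xop_ket a s : Xop R kappa a (ket R s) =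
  \sum_(x \in min_of_color kappa a s) ket R (to_ideal s x).
Proof. exact: linext_ket. Qed.

Lemma Yop_ket a s : Yop R kappa a (ket R s) =
  \sum_(x \in max_of_color kappa a s) ket R (to_filter s x).
Proof. exact: linext_ket. Qed.

Local Notation K := (R[i] : numDomainType).
Local Notation W := (V : lmodType K).
Local Notation ket := (@ket R d P).
Local Notation coord := (fun s => @coeff R d P s : {scalar W}).

Lemma upper_minuscule_weight H :
  upper_minuscule kappa H -> exists c, upper_weight c.
Proof.
case=> -[fin diag [_ _ HX]] _ eig HN1.
apply: (@relations_weight K W (fisplit P) ket coord (@coeff_ket R d P) G P
  (min_of_color kappa) (@to_ideal d P) (@to_ideal_inj G d P kappa)
  (Xop R kappa) Xop_ket 1 H isT fin).
- move=> a s; have [z Hz] := diag a s.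
  have [|m m1 mz] := eig z; first by exists a, s.
  by exists m; [exact: m1|rewrite (mul1r m) mz; exact: Hz].
- by move=> a s; rewrite mulrN1z scaleN1r; exact: HN1.
- by move=> a b v; rewrite (mul1r (theta a b)); exact: HX.
Qed.

Lemma lower_minuscule_weight H :
  lower_minuscule kappa H -> exists c, lower_weight c.
Proof.
case=> -[fin diag [_ _ HY]] _ eig HN1.
apply: (@relations_weight K W (fisplit P) ket coord (@coeff_ket R d P) G P
  (max_of_color kappa) (@to_filter d P) (@to_filter_inj G d P kappa)
  (Yop R kappa) Yop_ket (-1) H isT fin).
- move=> a s; have [z Hz] := diag a s.
  have [|m m1 mz] := eig z; first by exists a, s.
  exists (- m); first by rewrite lerN2.
  by rewrite (mulN1r (- m)) (opprK m) mz; exact: Hz.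
- by move=> a s; rewrite (opprK (1 : int)) scale1r; exact: HN1.
- by move=> a b v; rewrite (mulN1r (theta a b)) rmorphN; exact: HY.
Qed.

Lemma weight_upper_minuscule c H : upper_weight c ->
  (forall a s, H a (ket s) = (c a s)%:~R *: ket s) ->
  upper_minuscule kappa H.
Proof.
move=> cP HE; have HE1 : @weight_op K W (fisplit P) ket G 1 c H.
  by move=> a s; rewrite (mul1r (c a s)); exact: HE.
have [fin XX HH HM sq0] := @weight_representation K W (fisplit P) ket
  (@eq_on_kets R d P) G P kappa (min_of_color kappa) (@to_ideal d P)
  (@min_color G d P kappa) (@to_ideal_diamond G d P kappa)
  (Xop R kappa) Xop_ket c 1 H cP HE1.
split; [split; first exact: fin|exact: sq0| |].
- by move=> a s; exists (c a s)%:~R; exact: HE.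
- split; [exact: XX|exact: HH|move=> a b v].
  by rewrite -(mul1r (theta a b)); exact: HM.
- move=> z [a [s]]; rewrite HE => /(congr1 (coeff s)).
  rewrite !linearZ /= coeff_ket eqxx !mulr1 => <-.
  by exists (c a s) => //; case: cP.
- move=> s a; have [_ <- _] := cP.
  have := @weight_op_eqN1 K W (fisplit P) ket coord (@coeff_ket R d P)
    G 1 c H a s isT HE1.
  by rewrite mulrN1z scaleN1r; apply.
Qed.

Lemma weight_lower_minuscule c H : lower_weight c ->
  (forall a s, H a (ket s) = (- c a s)%:~R *: ket s) ->
  lower_minuscule kappa H.
Proof.
move=> cP HE; have HE1 : @weight_op K W (fisplit P) ket G (-1) c H.
  by move=> a s; rewrite (mulN1r (c a s)); exact: HE.
have [fin YY HH HM sq0] := @weight_representation K W (fisplit P) ket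
  (@eq_on_kets R d P) G P kappa (max_of_color kappa) (@to_filter d P)
  (@max_color G d P kappa) (@to_filter_diamond G d P kappa)
  (Yop R kappa) Yop_ket c (-1) H cP HE1.
split; [split; first exact: fin|exact: sq0| |].
- by move=> a s; exists (- c a s)%:~R; exact: HE.
- split; [exact: YY|exact: HH|move=> a b v].
  by rewrite -rmorphN -(mulN1r (theta a b)); exact: HM.
- move=> z [a [s]]; rewrite HE => /(congr1 (coeff s)).
  rewrite !linearZ /= coeff_ket eqxx !mulr1 => <-.
  by exists (- c a s) => //; case: cP => c1 _ _; rewrite /= lerNl.
- move=> s a; have [_ <- _] := cP.
  have := @weight_op_eqN1 K W (fisplit P) ket coord (@coeff_ket R d P)
    G (-1) c H a s isT HE1.
  by rewrite (opprK (1 : int)) scale1r; apply.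
Qed.

End Minuscule.

(** * Extremal elements and covers in a locally finite poset *)

Lemma finite_minimal d (P : porderType d) (A : set P) :
  finite_set A -> A !=set0 -> exists x, minimal_in A x.
Proof.
move=> /finite_fsetP[D ->]; have [n] := ubnP #|` D|.
elim: n D => // n IHn D; rewrite ltnS => Dn [x xD].
have [xmin|] := pselect (forall y, [set` D] y -> ~~ (y < x)%O).
  by exists x; split.
move=> /existsNP[y /not_implyP[yD /negP]]; rewrite negbK => yx.
pose E := [fset z in D | (z < x)%O]%fset.
have ED : (#|` E| < #|` D|)%N.
  rewrite (cardfsD1 x D) [x \in D]xD add1n ltnS fsubset_leq_card //.
  apply/fsubsetP => z; rewrite !inE => /andP[zD zx].
  by rewrite zD andbT; apply: contraTneq zx => ->; rewrite ltxx.
have [|z [zE zmin]] := IHn E (leq_trans ED Dn); first by exists y; rewrite /= !inE yD.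
have {zE}[/= zD zx] : z \in D /\ (z < x)%O by move: zE; rewrite /= !inE => /andP[].
exists z; split=> // w wD; apply/negP => wz.
by have := zmin w; rewrite /= !inE [w \in D]wD wz (lt_trans wz zx) => /(_ isT).
Qed.

Lemma finite_maximal d (P : porderType d) (A : set P) :
  finite_set A -> A !=set0 -> exists x, maximal_in A x.
Proof. exact: (@finite_minimal _ P^d). Qed.

Section LocallyFinite.
Context (d : Order.disp_t) (P : porderType d).
Hypothesis locfin : locally_finite_poset P.
Implicit Types (x y z : P) (A : set P).

Lemma maximal_above A x u : A x -> (forall z, A z -> (x <= z)%O -> (z <= u)%O) ->
  exists2 y, maximal_in A y & (x <= y)%O.
Proof.
move=> Ax Au; have [||y [[Ay xy] ymax]] :=
  @finite_maximal _ _ [set z | A z /\ (x <= z)%O].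
- by apply: sub_finite_set (locfin x u) => z [Az xz] /=; rewrite xz Au.
- by exists x.
exists y => //; split=> // z Az; apply/negP => yz.
by have := ymax z (conj Az (le_trans xy (ltW yz))); rewrite yz.
Qed.

Lemma minimal_below A x u : A x -> (forall z, A z -> (z <= x)%O -> (u <= z)%O) ->
  exists2 y, minimal_in A y & (y <= x)%O.
Proof.
move=> Ax Au; have [||y [[Ay xy] ymin]] :=
  @finite_minimal _ _ [set z | A z /\ (z <= x)%O].
- by apply: sub_finite_set (locfin u x) => z [Az xz] /=; rewrite xz Au.
- by exists x.
exists y => //; split=> // z Az; apply/negP => yz.
by have := ymin z (conj Az (le_trans (ltW yz) xy)); rewrite yz.
Qed.

Lemma cover_below x y : (x < y)%O -> exists2 z, (x <= z)%O & covered_by z y.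
Proof.
move=> xy; have [z /ltW //|z [zy zmax] xz] :=
  @maximal_above [set z | (z < y)%O] x y xy.
by exists z => //; split=> // w; apply/negP => /andP[zw /zmax/negP].
Qed.

Lemma cover_above x y : (x < y)%O -> exists2 z, (z <= y)%O & covered_by x z.
Proof.
move=> xy; have [z /ltW //|z [xz zmin] zy] :=
  @minimal_below [set z | (x < z)%O] y x xy.
by exists z => //; split=> // w; apply/negP => /andP[/zmin/negP].
Qed.

End LocallyFinite.

(** * From an upper weight to the coloring properties *)

Section FromWeight.
Context (G : sgraph) (d : Order.disp_t) (P : porderType d) (kappa : P -> G).
Hypothesis locfin : locally_finite_poset P.
Context (c : G -> fisplit P -> int).
Hypothesis cP : upper_weight kappa c.
Implicit Types (a b : G) (s t : fisplit P) (x y z : P).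

Let moves := @to_ideal_diamond G d P kappa.

Definition split_of (F : set P) (filtF : is_filter F) : fisplit P :=
  FISplit filtF (erefl (~` F)).

Lemma weight_min s x : minimal_in (filt s) x -> c (kappa x) s = -1.
Proof. by move=> mx; apply: (weight_at_step cP (x := x)). Qed.

Lemma weight_to_ideal b s x : minimal_in (filt s) x ->
  c b (to_ideal s x) = c b s + theta (kappa x) b.
Proof. by move=> mx; case: cP => _ _; apply. Qed.

Lemma minimal_same_color s x y :
  minimal_in (filt s) x -> minimal_in (filt s) y -> kappa x = kappa y -> x = y.
Proof.
move=> mx my kxy; have sx : min_of_color kappa (kappa x) s x by [].
by have sy : min_of_color kappa (kappa x) s y; last exact: (step_uniq moves cP sx sy).
Qed.

Definition filter2 x y : set P := [set z | (x <= z)%O \/ (y <= z)%O].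

Lemma filter2P x y : is_filter (filter2 x y).
Proof. by move=> u v [] /= uv /(le_trans uv) ?; [left|right]. Qed.

Lemma filter2_minimal x y : ~~ (x >=< y)%O ->
  minimal_in (filter2 x y) x /\ minimal_in (filter2 x y) y.
Proof.
rewrite /Order.comparable negb_or => /andP[xy yx].
split; split=> [|z [xz|yz]]; [by left; exact: lexx| | |by right; exact: lexx| |].
- by rewrite le_gtF.
- by apply: contra yx => /ltW; apply: le_trans.
- by apply: contra xy => /ltW; apply: le_trans.
- by rewrite le_gtF.
Qed.

Lemma weight_EC : prop_EC kappa.
Proof.
move=> x y kxy; apply: contrapT => /negP nxy; have [mx my] := filter2_minimal nxy.
have := minimal_same_color (s := split_of (@filter2P x y)) mx my kxy.
by move=> xy; rewrite xy comparablexx in nxy.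
Qed.

Lemma weight_AC : prop_AC kappa.
Proof.
move=> x y kxy; apply: contrapT => /negP nxy; have [mx my] := filter2_minimal nxy.
pose s := split_of (@filter2P x y).
have [/(_ (kappa x) (to_ideal s y)) + _ _] := cP.
rewrite weight_to_ideal // (@weight_min s x mx) /theta adj_sym kxy.
by case: eqP kxy => // ->; rewrite adj_irrefl.
Qed.

Definition filter1 x : set P := [set z | (x <= z)%O].

Lemma filter1P x : is_filter (filter1 x).
Proof. by move=> u v /= xu /(le_trans xu). Qed.

Definition principal_split x : fisplit P := split_of (@filter1P x).

Lemma principal_split_min x : minimal_in (filt (principal_split x)) x.
Proof. by split=> [|z xz] /=; rewrite /filter1 /= ?lexx ?le_gtF. Qed.

Lemma principal_split_minE x y : minimal_in (filt (principal_split x)) y -> y = x.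
Proof.
move=> [xy /(_ x (lexx x))]; rewrite lt_neqAle xy andbT negbK.
by move=> /eqP.
Qed.

(** In the filter generated by [x] only [x] can be moved, and moving it uncovers
[y].  Equal colors contradict the weight [1] after the move; if the colors were
distant, [y] would have been movable from the start. *)
Lemma weight_covered_adj x y : covered_by x y -> adj (kappa x) (kappa y).
Proof.
move=> [xy nxy]; pose s := principal_split x; have mx := principal_split_min x.
have sx : min_of_color kappa (kappa x) s x by [].
have sy : min_of_color kappa (kappa y) (to_ideal s x) y.
  split=> //; rewrite filt_to_ideal //; split=> [|z [xz zx]].
    by split; [exact: ltW|move=> /= yx; rewrite yx ltxx in xy].
  apply: contra (nxy z) => ->; rewrite andbT lt_neqAle [(x <= z)%O]xz andbT.
  by apply/eqP => /esym.
apply: contrapT => /negP nadj.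
have [kxy|kxy] := eqVneq (kappa x) (kappa y).
  have := weight_at_step cP sy.
  by rewrite -kxy (weight_same_color cP sx).
have dxy : distant (kappa x) (kappa y) by rewrite /distant kxy.
have [[my _] _ _] := distant_step (@min_color _ _ _ kappa) moves cP dxy sx sy.
by move: xy; rewrite (principal_split_minE my) ltxx.
Qed.

Lemma weight_NA : prop_NA kappa.
Proof.
by move=> x y [|] /weight_covered_adj; rewrite // adj_sym.
Qed.

(** As [filt t] is a filter, [D] is downward closed in [filt s], so its elements
can be moved one after the other, a minimal one each time. *)
Lemma weight_remove a (D : {fset P}) s t : [set` D] `<=` filt s ->
  filt t = filt s `\` [set` D] ->
  c a t = c a s + \sum_(z <- D) theta (kappa z) a.
Proof.
have [n] := ubnP #|` D|; elim: n D s => // n IHn D s; rewrite ltnS => Dn Ds tE.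
have [D0|/fset0Pn[x0 x0D]] := eqVneq D fset0.
  rewrite D0 big_nil addr0; congr (c a _); apply: fisplit_eq.
  by rewrite tE D0 set_fset0 setD0.
have [|x [xD xmin]] := @finite_minimal _ P [set` D] (finite_fset D).
  by exists x0.
have mx : minimal_in (filt s) x.
  split=> [|z Fz]; first exact: Ds.
  apply/negP => zx; have [zD|zD] := boolP (z \in D).
    by have := xmin z zD; rewrite zx.
  have : filt t z by rewrite tE; split=> //; exact/negP.
  by move=> /filtP /(_ (ltW zx)); rewrite tE => -[_]; apply.
rewrite (IHn (D `\ x)%fset (to_ideal s x)) ?weight_to_ideal //.
- by rewrite [in RHS](big_fsetD1 x) //= addrA.
- by move: Dn; rewrite (cardfsD1 x D) [x \in D]xD add1n.
- rewrite filt_to_ideal // => z /=; rewrite !inE => /andP[/eqP zx zD].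
  by split=> //; exact: Ds.
- rewrite filt_to_ideal // tE; apply/seteqP; split=> z /=.
    move=> [Fz zD]; split; last by rewrite !inE (negPf (introN idP zD)) andbF.
    by split=> // zx; apply: zD; rewrite zx.
  move=> [[Fz zx]]; rewrite !inE => zD; split=> // zD'; apply: zD.
  by rewrite zD' andbT; apply/eqP.
Qed.

(** The weight is [-1] at the filter generated by [x]; then [x] contributes [2] and
each element of adjacent color [-1]. *)
Lemma weight_above a x (D : {fset P}) t :
  kappa x = a -> x \in D -> (forall z, z \in D -> (x <= z)%O) ->
  (forall z, z \in D -> kappa z = a -> z = x) ->
  filt t = filter1 x `\` [set` D] ->
  c a t = 1 - #|` [fset z in D | adj (kappa z) a]%fset|%:Z.
Proof.
move=> kx xD Dx Da tE.
rewrite (@weight_remove a D (principal_split x) t) //.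
rewrite -{1}kx (weight_min (principal_split_min x)).
rewrite (eq_big_seq (fun z => (if z == x then 2 else 0) -
                              (if adj (kappa z) a then 1 else 0))); last first.
  move=> z zD; rewrite /theta; have [->|zx] := eqVneq z x.
    by rewrite kx eqxx adj_irrefl subr0.
  case: eqP => [/(Da z zD)/eqP|_]; first by rewrite (negPf zx).
  by case: adj; rewrite ?subr0 ?sub0r.
rewrite sumrB -!big_mkcond /= addrA.
rewrite [\sum_(i <- D | i == x) _]big_fset_condE.
rewrite [\sum_(i <- D | adj _ _) _]big_fset_condE /=.
have -> : [fset i in D | i == x]%fset = [fset x]%fset.
  apply/fsetP => z; rewrite !inE andbC.
  by case: eqP => [->|//]; rewrite xD.
by rewrite big_seq_fset1 card_fset_sum1 (raddf_sum Posz).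
Qed.

(** Both [x] in its filter and [y] after the move of the half-open interval are
movable, so the weight is [-1] before and after. *)
Lemma weight_I2A : prop_I2A kappa.
Proof.
move=> a x y [kx ky xy nxy].
have fin : finite_set [set z | (x <= z < y)%O].
  by apply: sub_finite_set (locfin x y) => z /= /andP[-> /ltW].
pose D := fset_set [set z | (x <= z < y)%O].
have DE z : (z \in D) = (x <= z < y)%O by rewrite in_fset_set // mem_setE.
have tF : is_filter (filter1 x `\` [set` D]).
  move=> u v [xu uD] uv; split; first exact: le_trans uv.
  move=> /= vD; apply: uD; move: vD; rewrite /= !DE => /andP[_ vy].
  by rewrite (le_lt_trans uv vy) andbT.
have my : minimal_in (filt (split_of tF)) y.
  split=> [|z [xz zD]]; first by split; [exact: ltW|rewrite /= DE ltxx andbF].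
  by apply/negP => zy; apply: zD; rewrite /= DE zy andbT.
have := weight_min my; rewrite [kappa y]ky (@weight_above a x D) //; first last.
- move=> z; rewrite DE => /andP[xz zy] kz; apply/eqP/negPn/negP => zx.
  by have := nxy z kz; rewrite zy andbT lt_neqAle eq_sym zx xz.
- by move=> z; rewrite DE => /andP[].
- by rewrite DE lexx.
move=> /(congr1 (fun i => 1 - i)); rewrite opprB addrCA subrr addr0.
move=> /(congr1 absz) /= card2.
(* [D] differs from the open interval by [x] only, whose color is [a] itself. *)
have -> : [set z | (x < z < y)%O /\ adj (kappa z) a] =
    [set` [fset z in D | adj (kappa z) a]%fset]; last exact/card_eq_fsetP.
apply/seteqP; split=> z /=; rewrite !inE DE.
  by move=> [/andP[/ltW -> ->]].
move=> /andP[/andP[xz zy] az]; rewrite zy andbT lt_neqAle xz andbT; split=> //.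
by apply: contraTneq az => <-; rewrite [kappa x]kx adj_irrefl.
Qed.

(** Moving everything from [x] up to two elements of adjacent color brings the weight
down to [-1], but [x], the last element of its color, has already been moved. *)
Lemma weight_Mx1GA : prop_Mx1GA kappa.
Proof.
move=> a x [kx xmax] z1 z2 [xz1 a1] [xz2 a2]; apply: contrapT => /eqP nz.
pose A := [set z | (x <= z <= z1)%O] `|` [set z | (x <= z <= z2)%O].
have fin : finite_set A by rewrite finite_setU; split; exact: locfin.
pose D := fset_set A.
have DE z : (z \in D) = (x <= z)%O && ((z <= z1)%O || (z <= z2)%O).
  rewrite in_fset_set // andb_orr; apply/idP/orP.
    by rewrite inE => -[]; [left|right].
  by move=> ?; rewrite inE.
have tF : is_filter (filter1 x `\` [set` D]).
  move=> u v [xu uD] uv; split; first exact: le_trans uv.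
  move=> /= vD; apply: uD; move: vD; rewrite /= !DE [(x <= u)%O]xu.
  by move=> /andP[_ /orP[] /(le_trans uv) ->]; rewrite ?orbT.
have above z : (x <= z)%O -> kappa z = a -> z = x.
  by move=> xz kz; apply/eqP; have := xmax z kz; rewrite lt_neqAle eq_sym xz andbT negbK.
have ct : c a (split_of tF) = 1 - #|` [fset z in D | adj (kappa z) a]%fset|%:Z.
  apply: (@weight_above a x D) => //.
  - by rewrite DE lexx (ltW xz1).
  - by move=> z; rewrite DE => /andP[].
  - by move=> z; rewrite DE => /andP[+ _]; apply: above.
have card2 : (2 <= #|` [fset z in D | adj (kappa z) a]%fset|)%N.
  have -> : 2%N = #|` [fset z1; z2]%fset| by rewrite cardfs2 nz.
  apply/fsubset_leq_card/fsubsetP => z; rewrite !inE DE.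
  by case/orP => /eqP ->; rewrite lexx ?orbT ltW.
have [/(_ a (split_of tF)) cge /(_ a (split_of tF)) [+ _] _] := cP.
case.
  apply/eqP; rewrite eq_le cge andbT ct lerBlDr addrC -lerBlDr opprK.
  by rewrite -[1 + 1]/(Posz 2) lez_nat.
move=> w [[[xw wD] _] kw]; apply: wD.
by rewrite /= (above w xw kw) DE lexx (ltW xz1).
Qed.

End FromWeight.

(** * Lower weights by order duality *)

Section Dual.
Context (G : sgraph) (d : Order.disp_t) (P : porderType d) (kappa : P -> G).
Local Notation Pd := (P^d : porderType _).

Lemma dual_split_filter (s : fisplit Pd) : is_filter (idl s : set P).
Proof. by move=> x y Ix xy; apply: (idl_ideal Ix). Qed.

Lemma dual_split_idl (s : fisplit Pd) : filt s = ~` (idl s) :> set P.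
Proof. by rewrite idlE setCK. Qed.

(** The same pair of sets with the roles of filter and ideal exchanged. *)
Definition dual_split (s : fisplit Pd) : fisplit P :=
  FISplit (@dual_split_filter s) (dual_split_idl s).

Lemma dual_to_ideal s x : minimal_in (P := Pd) (filt s) x ->
  dual_split (to_ideal s x) = to_filter (dual_split s) x.
Proof.
move=> mx; apply: fisplit_eq; rewrite filt_to_filter //=.
exact: (@idl_to_ideal _ Pd).
Qed.

(** Reversing the order exchanges the two kinds of moves; the change of sign is
already part of the convention for lower weights. *)
Lemma dual_weight c : lower_weight kappa c ->
  upper_weight (P := Pd) kappa (fun a s => c a (dual_split s)).
Proof.
case=> cge cN1 cact; split=> [a s|a s|a b s x sx]; first exact: cge.
  exact: cN1.
by rewrite dual_to_ideal; [exact: cact|case: sx].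
Qed.

Lemma dual_locally_finite : locally_finite_poset P -> locally_finite_poset Pd.
Proof.
move=> locfin x y; apply: sub_finite_set (locfin y x) => z /=.
by rewrite !leEdual andbC.
Qed.

Lemma lower_weight_properties c : locally_finite_poset P ->
  lower_weight kappa c ->
  [/\ prop_EC kappa, prop_NA kappa, prop_AC kappa, prop_I2A kappa
    & prop_Mn1LA kappa].
Proof.
move=> /dual_locally_finite locfin /dual_weight cP; split.
- move=> x y /(weight_EC cP); rewrite /Order.comparable !leEdual.
  by rewrite orbC.
- move=> x y xy; apply: (weight_NA cP).
  case: xy => -[xy nxy]; [right|left]; split=> // z; rewrite !ltEdual andbC; exact: nxy.
- move=> x y /(weight_AC cP); rewrite /Order.comparable !leEdual.
  by rewrite orbC.
- move=> a x y [kx ky xy nxy].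
  have cyx : consecutive (P := Pd) kappa a y x.
    by split=> // z kz; rewrite !ltEdual andbC; exact: nxy.
  have := weight_I2A locfin cP cyx; set A := (X in (X #= `I_2)%card).
  suff -> : [set z | (x < z < y)%O /\ adj (kappa z) a] = A by [].
  by apply/seteqP; split=> z [/andP[xz zy] az]; split=> //; apply/andP.
- move=> a x [kx xmin] z1 z2 z1P z2P.
  by apply: (weight_Mx1GA locfin cP (a := a) (x := x)).
Qed.

Lemma upper_weight_properties c : locally_finite_poset P ->
  upper_weight kappa c ->
  [/\ prop_EC kappa, prop_NA kappa, prop_AC kappa, prop_I2A kappa
    & prop_Mx1GA kappa].
Proof.
move=> locfin cP; split.
- exact: weight_EC cP.
- exact: weight_NA cP.
- exact: weight_AC cP.
- exact: weight_I2A cP.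
- exact: weight_Mx1GA cP.
Qed.

End Dual.

(** * Counting elements of adjacent colors *)

Section FiniteCardinal.
Context (T : choiceType).
Implicit Types (A B : set T) (x : T).

(** Meaningful for finite sets only: [fset_set] is empty on infinite ones. *)
Definition ncard A : nat := #|` fset_set A|.

Lemma ncard_le A B : finite_set B -> A `<=` B -> (ncard A <= ncard B)%N.
Proof.
move=> finB AB; apply/fsubset_leq_card/fsubsetP => x.
by rewrite !in_fset_set ?inE; [exact: AB|exact: finB|exact: sub_finite_set finB].
Qed.

Lemma ncardU1 A x : finite_set A -> ~ A x -> ncard (A `|` [set x]) = (ncard A).+1.
Proof.
move=> finA Ax; rewrite /ncard setUC fset_setU1 // cardfsU1 in_fset_set //.
by rewrite memNset.
Qed.

Lemma ncard0 : ncard (set0 : set T) = 0%N.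
Proof. by rewrite /ncard fset_set0. Qed.

Lemma ncard_eq0 A : finite_set A -> ncard A = 0%N -> A = set0.
Proof. by move=> finA /eqP; rewrite cardfs_eq0 => /eqP/fset_set_set0; apply. Qed.

Lemma ncard_subset1 A : is_subset1 A -> finite_set A /\ (ncard A <= 1)%N.
Proof.
move=> A1; have [->|/set0P[x Ax]] := eqVneq A set0.
  by rewrite ncard0; split.
have -> : A = [set x] by apply/seteqP; split=> [y Ay|y ->//]; exact: A1.
by split=> //; rewrite /ncard fset_set1 cardfs1.
Qed.

Lemma ncard_eq_sub A B : finite_set B -> A `<=` B -> ncard A = ncard B -> A = B.
Proof.
move=> finB AB cAB; have finA := sub_finite_set AB finB.
apply: fset_set_inj => //; apply/eqP; rewrite eqEfcard [X in _ && X]eq_leq ?andbT.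
  by apply/fsubsetP => x; rewrite !in_fset_set // !inE; exact: AB.
by rewrite -[LHS]/(ncard B) -cAB.
Qed.

End FiniteCardinal.

Section AdjacentCount.
Context (G : sgraph) (d : Order.disp_t) (P : porderType d) (kappa : P -> G).
Implicit Types (A B : set P) (a b : G) (x z : P).

Definition adj_count_set b A : set P :=
  [set z | [/\ A z, adj (kappa z) b & finite_set (Pcol kappa (kappa z) `&` A)]].

Definition adj_infinite b A : Prop :=
  exists a, adj a b /\ infinite_set (Pcol kappa a `&` A).

(** The common shape of [upsilon] and [psi]: elements of adjacent color are counted
one by one in the finite color classes, and all the infinite color classes
together count for one. *)
Definition adj_count b A : nat :=
  (ncard (adj_count_set b A) + `[< adj_infinite b A >])%N.

Lemma finite_adj_count_set b A : finite_set (adj_count_set b A).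
Proof.
apply: (@sub_finite_set _ _ (\bigcup_(a in
    [set a | finite_set (Pcol kappa a `&` A)]) (Pcol kappa a `&` A))).
  by move=> z [Az _ fin]; exists (kappa z).
by apply: bigcup_finite; [exact: finite_finset|].
Qed.

Lemma eq_adj_count b A B :
  (forall z, adj (kappa z) b -> A z <-> B z) -> adj_count b A = adj_count b B.
Proof.
move=> AB; have colE a : adj a b -> Pcol kappa a `&` A = Pcol kappa a `&` B.
  by move=> ab; apply/seteqP; split=> z [kz zA]; split=> //;
    apply/AB; rewrite // [kappa z]kz.
congr (ncard _ + nat_of_bool _)%N.
  by apply/seteqP; split=> z [zA zb]; [rewrite colE //|rewrite -colE //];
    split=> //; apply/AB.
by apply: asbool_equiv_eq; split=> -[a [ab]]; [rewrite colE //|rewrite -colE //];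
  exists a.
Qed.

Lemma adj_count_add b A x : ~ A x -> adj (kappa x) b ->
  finite_set (Pcol kappa (kappa x) `&` A) ->
  adj_count b (A `|` [set x]) = (adj_count b A).+1.
Proof.
move=> Ax xb finx.
have finE a : finite_set (Pcol kappa a `&` (A `|` [set x])) <->
    finite_set (Pcol kappa a `&` A).
  rewrite setIUr finite_setU; split=> [[]//|fin]; split=> //.
  exact: sub_finite_set (finite_set1 x).
rewrite /adj_count -addSn.
rewrite -(@ncardU1 _ _ x); [|exact: finite_adj_count_set|by case].
congr (ncard _ + nat_of_bool _)%N.
  apply/seteqP; split=> z /=.
    by move=> [[Az|->] zb /finE fin]; [left|right].
  by move=> [[Az zb /finE fin]|->]; split=> //; [left|right|apply/finE].
by apply: asbool_equiv_eq; split=> -[a [ab inf]]; exists a; split=> // /finE.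
Qed.

Lemma adj_count_finite b A : finite_set [set z | A z /\ adj (kappa z) b] ->
  adj_count b A = ncard [set z | A z /\ adj (kappa z) b].
Proof.
move=> fin; have fina a : adj a b -> finite_set (Pcol kappa a `&` A).
  by move=> ab; apply: sub_finite_set fin => z [kz Az]; split; rewrite // [kappa z]kz.
rewrite /adj_count asboolF ?addn0.
  congr ncard; apply/seteqP; split=> z [Az zb] //.
  by split=> //; exact: fina.
by move=> [a [/fina]].
Qed.

Lemma adj_count_eq0 b A :
  adj_count b A = 0%N <-> (forall z, A z -> ~~ adj (kappa z) b).
Proof.
split=> [/eqP|nA]; last first.
  have e : [set z | A z /\ adj (kappa z) b] = set0.
    by apply/seteqP; split=> z // [Az]; apply/negP/nA.
  by rewrite adj_count_finite e ?ncard0.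
rewrite /adj_count addn_eq0 eqb0 => /andP[/eqP/ncard_eq0 e0 /asboolPn fin] z Az.
apply/negP => zb; suff : adj_count_set b A z.
  by rewrite e0 //; exact: finite_adj_count_set.
by split=> //; apply: contrapT => inf; apply: fin; exists (kappa z).
Qed.

End AdjacentCount.

(** * The weight mu *)

Section Mu.
Context (G : sgraph) (d : Order.disp_t) (P : porderType d) (kappa : P -> G).
Hypothesis locfin : locally_finite_poset P.
Hypothesis kappa_surj : forall a : G, exists x : P, kappa x = a.
Hypotheses (EC : prop_EC kappa) (NA : prop_NA kappa) (AC : prop_AC kappa).
Hypothesis I2A : prop_I2A kappa.
Implicit Types (a b : G) (s : fisplit P) (x y z : P).

Lemma upsilonE b s y : maximal_in (Pcol kappa b `&` idl s) y ->
  upsilon kappa b s = adj_count kappa b [set z | idl s z /\ (y < z)%O].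
Proof.
move=> my; rewrite /upsilon; case: pselect => [h|[]]; last by exists y.
have -> : projT1 (cid h) = y.
  case: (cid h) => y' [[ky' Iy'] y'max] /=; case: my => -[ky Iy] ymax.
  have := EC (etrans ky' (esym ky)); rewrite /Order.comparable !le_eqVlt.
  rewrite (negPf (y'max y _)) // (negPf (ymax y' _)) // !orbF.
  by case/orP => /eqP.
rewrite /adj_count /ncard; congr (#|` fset_set _| + nat_of_bool _)%N.
  apply/seteqP; split=> z /=.
    move=> [Iz yz zb fin]; split=> //; apply: sub_finite_set fin => u.
    by move=> [ku [Iu yu]].
  move=> [[Iz yz] zb fin]; split=> //; apply: sub_finite_set fin => u.
  by move=> [ku Iu yu].
apply: asbool_equiv_eq.
split=> -[a [ab inf]]; exists a; split=> // fin; apply: inf.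
  by apply: sub_finite_set fin => u [ku Iu yu].
by apply: sub_finite_set fin => u [ku [Iu yu]].
Qed.

Lemma psiE b s y : minimal_in (Pcol kappa b `&` filt s) y ->
  psi kappa b s = adj_count kappa b [set z | filt s z /\ (z < y)%O].
Proof.
move=> my; rewrite /psi; case: pselect => [h|[]]; last by exists y.
have -> : projT1 (cid h) = y.
  case: (cid h) => y' [[ky' Iy'] y'min] /=; case: my => -[ky Iy] ymin.
  have := EC (etrans ky' (esym ky)); rewrite /Order.comparable !le_eqVlt.
  rewrite (negPf (y'min y _)) // (negPf (ymin y' _)) // !orbF.
  by case/orP => /eqP.
rewrite /adj_count /ncard; congr (#|` fset_set _| + nat_of_bool _)%N.
  apply/seteqP; split=> z /=.
    move=> [Iz yz zb fin]; split=> //; apply: sub_finite_set fin => u.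
    by move=> [ku [Iu yu]].
  move=> [[Iz yz] zb fin]; split=> //; apply: sub_finite_set fin => u.
  by move=> [ku Iu yu].
apply: asbool_equiv_eq.
split=> -[a [ab inf]]; exists a; split=> // fin; apply: inf.
  by apply: sub_finite_set fin => u [ku Iu yu].
by apply: sub_finite_set fin => u [ku [Iu yu]].
Qed.

Lemma upsilon_nomax b s :
  ~ (exists y, maximal_in (Pcol kappa b `&` idl s) y) -> upsilon kappa b s = 1%N.
Proof. by rewrite /upsilon; case: pselect. Qed.

Lemma psi_nomin b s :
  ~ (exists y, minimal_in (Pcol kappa b `&` filt s) y) -> psi kappa b s = 1%N.
Proof. by rewrite /psi; case: pselect. Qed.

Lemma filt_idl_comparable s x y : filt s x -> idl s y -> (x >=< y)%O -> (y < x)%O.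
Proof.
rewrite idlE => Fx Iy /orP[xy|]; first by case: Iy; exact: filtP xy.
by rewrite le_eqVlt => /orP[/eqP yx|//]; case: Iy; rewrite yx.
Qed.

(** If the last element [y] of color [b] in the ideal is not maximal there, one of
its covers lies in the ideal, and by NA that cover is counted. *)
Lemma upsilon_eq0 b s : upsilon kappa b s = 0%N <-> max_of_color kappa b s !=set0.
Proof.
split=> [u0|[x [[Ix xmax] kx]]]; last first.
  rewrite (@upsilonE b s x); last by split=> // y [_ Iy]; exact: xmax.
  by apply/adj_count_eq0 => z [/xmax/negP].
have [[y my]|no] :=
    pselect (exists y, maximal_in (Pcol kappa b `&` idl s) y);
  last by rewrite upsilon_nomax in u0.
move: u0; rewrite (upsilonE my) adj_count_eq0 => nadj.
case: my => -[ky Iy] ymax; exists y; split=> //; split=> // z Iz; apply/negP => yz.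
have [w wz yw] := cover_above locfin yz.
have Iw : idl s w := idl_ideal Iz wz.
have := nadj w (conj Iw yw.1); rewrite -[b]ky.
by rewrite (NA (or_intror yw)).
Qed.

Lemma psi_eq0 b s : psi kappa b s = 0%N <-> min_of_color kappa b s !=set0.
Proof.
split=> [u0|[x [[Fx xmin] kx]]]; last first.
  rewrite (@psiE b s x); last by split=> // y [_ Fy]; exact: xmin.
  by apply/adj_count_eq0 => z [/xmin/negP].
have [[y my]|no] :=
    pselect (exists y, minimal_in (Pcol kappa b `&` filt s) y);
  last by rewrite psi_nomin in u0.
move: u0; rewrite (psiE my) adj_count_eq0 => nadj.
case: my => -[ky Fy] ymin; exists y; split=> //; split=> // z Fz; apply/negP => zy.
have [w zw wy] := cover_below locfin zy.
have Fw : filt s w := filtP Fz zw.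
have := nadj w (conj Fw wy.1); rewrite -[b]ky.
by rewrite (NA (or_introl wy)).
Qed.

Definition adj_between b x y : set P :=
  [set z | (x < z < y)%O /\ adj (kappa z) b].

Lemma finite_adj_between b x y : finite_set (adj_between b x y).
Proof.
by apply: sub_finite_set (locfin x y) => z [/andP[/ltW xz /ltW zy] _] /=; rewrite xz.
Qed.

Lemma ncard_adj_between b x y : consecutive kappa b x y ->
  ncard (adj_between b x y) = 2%N.
Proof. by move=> /I2A; exact: card_fset_set. Qed.

(** By AC, elements of the ideal with color adjacent to [b] lie below any element of
color [b] in the filter, so only finitely many of them are above [y]. *)
Lemma upsilon_between b s y y' :
  maximal_in (Pcol kappa b `&` idl s) y -> Pcol kappa b y' -> filt s y' ->
  upsilon kappa b s = ncard (adj_between b y y' `&` idl s).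
Proof.
move=> my ky' Fy'; rewrite (upsilonE my).
have E : [set z | [set z | idl s z /\ (y < z)%O] z /\ adj (kappa z) b] =
    adj_between b y y' `&` idl s.
  apply/seteqP; split=> z /= [].
    move=> [Iz yz] zb; split=> //; split=> //; rewrite yz /=.
    apply: (filt_idl_comparable Fy' Iz); rewrite comparable_sym.
    by apply: AC; rewrite ky'.
  by move=> [/andP[yz _] zb] Iz.
rewrite adj_count_finite E //.
exact: sub_finite_set (@subIsetl _ _ _) (finite_adj_between b y y').
Qed.

Lemma exists_maximal_idl b s x p :
  (forall z, kappa z = b -> idl s z -> (z < x)%O) -> kappa p = b -> idl s p ->
  exists y, maximal_in (Pcol kappa b `&` idl s) y.
Proof.
move=> Ix kp Ip.
have [|z [kz Iz] _|y my _] := @maximal_above _ _ locfin (Pcol kappa b `&` idl s) p x.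
- by split.
- exact/ltW/Ix.
- by exists y.
Qed.

Lemma exists_minimal_filt b s x p :
  (forall z, kappa z = b -> filt s z -> (x < z)%O) -> kappa p = b -> filt s p ->
  exists y, minimal_in (Pcol kappa b `&` filt s) y.
Proof.
move=> Fx kp Fp.
have [|z [kz Fz] _|y my _] := @minimal_below _ _ locfin (Pcol kappa b `&` filt s) p x.
- by split.
- exact/ltW/Fx.
- by exists y.
Qed.

Lemma consecutive_max_idl b s y y' :
  maximal_in (Pcol kappa b `&` idl s) y -> minimal_in (Pcol kappa b `&` filt s) y' ->
  consecutive kappa b y y'.
Proof.
move=> [[ky Iy] ymax] [[ky' Fy'] y'min]; split=> //.
  by apply: (filt_idl_comparable Fy' Iy); apply: EC; rewrite [LHS]ky'.
move=> z kz; apply/negP => /andP[yz zy'].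
have [Iz|/filtPn Fz] := pselect (idl s z).
  by have := ymax z (conj kz Iz); rewrite yz.
by have := y'min z (conj kz Fz); rewrite zy'.
Qed.

(** The movable [x] and the last element [y] of its color in the ideal are consecutive,
and everything strictly between them lies in the ideal: the count is the one
of I2A. *)
Lemma upsilon_min_of_color b s x : min_of_color kappa b s x ->
  Pcol kappa b `&` idl s !=set0 -> upsilon kappa b s = 2%N.
Proof.
move=> [[Fx xmin] kx] [p [kp Ip]].
have [|//|//|y my] := @exists_maximal_idl b s x p.
  move=> z kz Iz; apply: (filt_idl_comparable Fx Iz).
  by apply: EC; rewrite kx kz.
rewrite (upsilon_between my kx Fx) -(@ncard_adj_between b y x); last first.
  by apply: (consecutive_max_idl my); split=> // z [_ /xmin].
congr ncard; apply/seteqP; split=> [z []//|z zb]; split=> //.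
by rewrite idlE => Fz; case: zb => /andP[_ zx] _; have := xmin z Fz; rewrite zx.
Qed.

Lemma mu_min_of_color b s : min_of_color kappa b s !=set0 -> mu kappa b s = -1.
Proof.
move=> ex; rewrite /mu; case: asboolP => [ne|_].
  by case: ex => x xm; rewrite (upsilon_min_of_color xm ne).
by move/psi_eq0: ex => ->; rewrite addr0.
Qed.

Lemma mu_max_of_color b s : max_of_color kappa b s !=set0 -> mu kappa b s = 1.
Proof.
move=> ex; rewrite /mu asboolT; last by case: ex => x [[Ix _] kx]; exists x.
by move/upsilon_eq0: ex => ->; rewrite subr0.
Qed.

Lemma min_to_ideal_max a s x : min_of_color kappa a s x ->
  max_of_color kappa a (to_ideal s x) x.
Proof.
move=> [[Fx xmin] kx]; split=> //; rewrite idl_to_ideal //.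
split=> [|z [Iz|->]]; [by right| |by rewrite ltxx].
by apply/negP => xz; move: Iz; rewrite idlE; apply; exact: filtP (ltW xz).
Qed.

Lemma max_to_filter_min a s y : max_of_color kappa a s y ->
  min_of_color kappa a (to_filter s y) y.
Proof.
move=> [[Iy ymax] ky]; split=> //; rewrite filt_to_filter //.
split=> [|z [Fz|->]]; [by right| |by rewrite ltxx].
by apply/negP => zy; move: Iy; rewrite idlE; apply; exact: filtP (ltW zy).
Qed.

Lemma to_filterK s y : maximal_in (idl s) y -> to_ideal (to_filter s y) y = s.
Proof.
move=> my; have [my' _] : min_of_color kappa (kappa y) (to_filter s y) y.
  exact: max_to_filter_min.
apply: fisplit_eq; rewrite filt_to_ideal // filt_to_filter // setDUl setDv setU0.
by rewrite not_setD1 //; case: my; rewrite idlE.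
Qed.

Lemma idl_lt_min a s x z : min_of_color kappa a s x -> (x >=< z)%O -> idl s z ->
  (z < x)%O.
Proof. by move=> [[Fx _] _] xz Iz; exact: filt_idl_comparable Iz xz. Qed.

Lemma filt_ge_min a s x z : min_of_color kappa a s x -> (x >=< z)%O -> filt s z ->
  (x <= z)%O.
Proof.
move=> [[Fx xmin] _] /orP[//|]; rewrite le_eqVlt => /orP[/eqP->//|zx] Fz.
by have := xmin z Fz; rewrite zx.
Qed.

(** The effect on [upsilon b] and [psi b] of moving an element [x] of another color.
For an adjacent color, AC makes [x] comparable with all elements of color [b];
by local finiteness the ideal (the filter, respectively) then has a last (a
first) element of color [b], and [x] is gained or lost by the set that is
counted. *)
Section Step.
Context (a b : G) (s : fisplit P) (x : P).
Hypotheses (sx : min_of_color kappa a s x) (ab : a != b).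

Let mx : minimal_in (filt s) x. Proof. by case: sx. Qed.
Let kx : kappa x = a. Proof. by case: sx. Qed.

Lemma Pcol_idl_step : Pcol kappa b `&` idl (to_ideal s x) = Pcol kappa b `&` idl s.
Proof.
rewrite idl_to_ideal // setIUr (_ : _ `&` [set x] = set0) ?setU0 //.
by apply/seteqP; split=> z // -[+ zx]; rewrite zx /Pcol /= kx => /eqP; rewrite (negPf ab).
Qed.

Lemma Pcol_filt_step : Pcol kappa b `&` filt (to_ideal s x) = Pcol kappa b `&` filt s.
Proof.
rewrite filt_to_ideal //; apply/seteqP; split=> z [kz]; first by move=> [].
move=> Fz; split=> //; split=> // zx; move/eqP: ab; apply.
by rewrite -kx -[x]zx.
Qed.

Lemma upsilon_step_distant : ~~ adj a b ->
  upsilon kappa b (to_ideal s x) = upsilon kappa b s.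
Proof.
move=> nab; have [[y my]|no] :=
    pselect (exists y, maximal_in (Pcol kappa b `&` idl s) y);
  last by rewrite !upsilon_nomax // Pcol_idl_step.
rewrite (upsilonE my) (@upsilonE b (to_ideal s x) y) ?Pcol_idl_step //.
apply: eq_adj_count => z zb; rewrite /= idl_to_ideal //; split=> [[[]//]|[]].
  by move=> zx; rewrite [z]zx kx (negPf nab) in zb.
by split=> //; left.
Qed.

Lemma psi_step_distant : ~~ adj a b ->
  psi kappa b (to_ideal s x) = psi kappa b s.
Proof.
move=> nab; have [[y my]|no] :=
    pselect (exists y, minimal_in (Pcol kappa b `&` filt s) y);
  last by rewrite !psi_nomin // Pcol_filt_step.
rewrite (psiE my) (@psiE b (to_ideal s x) y) ?Pcol_filt_step //.
apply: eq_adj_count => z zb; rewrite /= filt_to_ideal //; split=> [[[]//]|[Fz zy]].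
by split=> //; split=> // zx; rewrite [z]zx kx (negPf nab) in zb.
Qed.

Lemma upsilon_step_adj : adj a b -> Pcol kappa b `&` idl s !=set0 ->
  upsilon kappa b (to_ideal s x) = (upsilon kappa b s).+1.
Proof.
move=> adjab [p [kp Ip]].
have lt_x z : kappa z = b -> idl s z -> (z < x)%O.
  by move=> kz; apply: (idl_lt_min sx); apply: AC; rewrite kx kz.
have [y my] := exists_maximal_idl lt_x kp Ip.
rewrite (upsilonE my) (@upsilonE b (to_ideal s x) y) ?Pcol_idl_step //.
rewrite -(@adj_count_add _ _ _ kappa b _ x); last first.
- apply: sub_finite_set (locfin y x) => z [kz [Iz yz]] /=; rewrite (ltW yz) /=.
  by apply/ltW/(idl_lt_min sx _ Iz)/EC.
- by rewrite kx.
- by rewrite /= idlE => -[]; case: mx.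
congr adj_count; rewrite idl_to_ideal //; apply/seteqP; split=> z /=.
  by move=> [[Iz|->] yz]; [left|right].
move=> [[Iz yz]|->]; first by split=> //; left.
by split; [right|case: my => -[ky Iy] _; exact: lt_x].
Qed.

Lemma psi_step_adj : adj a b -> ~ (Pcol kappa b `&` idl s !=set0) ->
  psi kappa b s = (psi kappa b (to_ideal s x)).+1.
Proof.
move=> adjab noI; have [p kp] := kappa_surj b.
have Fp : filt s p by apply/filtPn => Ip; apply: noI; exists p.
have gt_x z : kappa z = b -> filt s z -> (x < z)%O.
  move=> kz Fz; rewrite lt_neqAle (filt_ge_min sx _ Fz) ?andbT.
    by apply: contraNneq ab => xz; rewrite -kx xz kz.
  by apply: AC; rewrite kx kz.
have [y my] := exists_minimal_filt gt_x kp Fp.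
rewrite (psiE my) (@psiE b (to_ideal s x) y) ?Pcol_filt_step //.
rewrite -(@adj_count_add _ _ _ kappa b _ x); last first.
- apply: sub_finite_set (locfin x y) => z [kz []] /=.
  rewrite filt_to_ideal // => -[Fz _] zy; rewrite (ltW zy) andbT.
  by apply: (filt_ge_min sx _ Fz); exact: EC.
- by rewrite kx.
- by rewrite /= filt_to_ideal // => -[[_ nx] _]; exact: nx erefl.
congr adj_count; rewrite filt_to_ideal //; apply/seteqP; split=> z /=.
  move=> [Fz zy]; have [->|zx] := eqVneq z x; first by right.
  by left; split=> //; split=> //; exact/eqP.
move=> [[[Fz _] zy]//|->]; split; first by case: mx.
by case: my => -[ky Fy] _; exact: gt_x.
Qed.

End Step.

Lemma mu_to_ideal a b s x : min_of_color kappa a s x ->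
  mu kappa b (to_ideal s x) = mu kappa b s + theta a b.
Proof.
move=> sx; have [<-|ab] := eqVneq a b.
  rewrite theta_diag mu_max_of_color; last by exists x; exact: min_to_ideal_max.
  by rewrite mu_min_of_color //; exists x.
rewrite /theta (negPf ab) /mu (Pcol_idl_step sx ab).
have [adjab|nadj] := boolP (adj a b); case: asboolP => I0.
- by rewrite (upsilon_step_adj sx ab adjab I0) intS opprD addrCA addrC.
- by rewrite (psi_step_adj sx ab adjab I0) intS addKr addrC.
- by rewrite (upsilon_step_distant sx ab nadj) addr0.
- by rewrite (psi_step_distant sx ab nadj) addr0.
Qed.

(** The point is the bound [upsilon <= 2] with its equality case.  Without a later
element of color [b], Mx1GA bounds the count by [1].  Otherwise the next one
is in the filter and I2A bounds the count by [2]; in the equality case both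
elements of adjacent color are in the ideal, so by NA nothing of the filter
can lie below that next element. *)
Lemma mu_upper_weight : prop_Mx1GA kappa -> upper_weight kappa (mu kappa).
Proof.
move=> Mx; suff mxP b s : Pcol kappa b `&` idl s !=set0 ->
    (upsilon kappa b s <= 2)%N /\
    (upsilon kappa b s = 2%N -> min_of_color kappa b s !=set0).
  split=> [b s|b s|]; last exact: mu_to_ideal.
    rewrite /mu; case: asboolP => [/mxP[u2 _]|_]; last by rewrite lerDl.
    by rewrite lerBrDr addrC -lerBrDr opprK lez_nat.
  split=> [|/mu_min_of_color //]; rewrite /mu; case: asboolP => [/mxP[_ u2]|_].
    by move=> /(congr1 (fun i => 1 - i)); rewrite subKr => -[/u2].
  by move=> /(canRL (addKr _)); rewrite addNr => -[/psi_eq0].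
move=> [p [kp Ip]].
have [[y my]|no] :=
    pselect (exists y, maximal_in (Pcol kappa b `&` idl s) y);
  last by rewrite upsilon_nomax.
have [[ky Iy] ymax] := my.
have [ymaxP|] := pselect (forall z, Pcol kappa b z -> ~~ (y < z)%O).
  have [fin le1] := ncard_subset1 (Mx b y (conj ky ymaxP)).
  have sub : [set z | [set z | idl s z /\ (y < z)%O] z /\ adj (kappa z) b] `<=`
      [set z | (y < z)%O /\ adj (kappa z) b] by move=> z [[]].
  have u1 : (upsilon kappa b s <= 1)%N.
    rewrite (upsilonE my) adj_count_finite; last exact: sub_finite_set fin.
    exact: leq_trans (ncard_le fin sub) le1.
  by split=> [|u2]; [exact: leq_trans u1 _|rewrite u2 in u1].
move=> /existsNP[z /not_implyP[kz /negP]]; rewrite negbK => yz.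
have Fz : filt s z by apply/filtPn => Iz; have := ymax z (conj kz Iz); rewrite yz.
have [|//|//|y' my'] := @exists_minimal_filt b s y z.
  move=> w kw Fw; apply: (filt_idl_comparable Fw Iy); apply: EC.
  by rewrite kw [kappa y]ky.
have [[ky' Fy'] y'min] := my'.
have c2 := ncard_adj_between (consecutive_max_idl my my').
have fin := finite_adj_between b y y'.
rewrite (upsilon_between my ky' Fy') -c2; split.
  by apply: ncard_le => // w [].
move=> /(ncard_eq_sub fin (@subIsetl _ _ _)) E.
exists y'; split=> //; split=> // w Fw; apply/negP => wy'.
(* [v] would be an element of adjacent color between [y] and [y'] in the filter. *)
have [v wv vy'] := cover_below locfin wy'.
have Fv : filt s v := filtP Fw wv.
have vb : adj (kappa v) b by rewrite -[b]ky'; apply: NA; left.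
have : adj_between b y y' v.
  split=> //; rewrite vy'.1 andbT; apply: (filt_idl_comparable Fv Iy).
  by apply: AC; rewrite [kappa y]ky.
by rewrite -E => -[_]; rewrite idlE.
Qed.

(** If the ideal has no element of color [b], the first element of color [b] in the
filter is minimal in the whole color class, and Mn1LA bounds [psi] by [1]:
then [mu] is at most [0].  The effect of a move is that of the opposite move of
the upper case. *)
Lemma mu_lower_weight : prop_Mn1LA kappa ->
  lower_weight kappa (fun a s => - mu kappa a s).
Proof.
move=> Mn.
have psi1 b s : ~ (Pcol kappa b `&` idl s !=set0) -> (psi kappa b s <= 1)%N.
  move=> noI.
  have [[y my]|no] := pselect (exists y, minimal_in (Pcol kappa b `&` filt s) y);
    last by rewrite psi_nomin.
  have ymin : minimal_in (Pcol kappa b) y.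
    case: my => -[ky Fy] ymin; split=> // z kz; apply: ymin; split=> //.
    by apply/filtPn => Iz; apply: noI; exists z.
  have [fin le1] := ncard_subset1 (Mn b y ymin).
  have sub : [set z | [set z | filt s z /\ (z < y)%O] z /\ adj (kappa z) b] `<=`
      [set z | (z < y)%O /\ adj (kappa z) b] by move=> z [[]].
  rewrite (psiE my) adj_count_finite; last exact: sub_finite_set fin.
  exact: leq_trans (ncard_le fin sub) le1.
split=> [b s|b s|a b s y sy].
- rewrite lerN2 /mu; case: asboolP => [_|/psi1 p1]; first by rewrite gerBl.
  by rewrite addrC lerBlDr (le_trans (y := 1)) // lez_nat.
- split=> [/oppr_inj|/mu_max_of_color -> //]; rewrite /mu.
  case: asboolP => [_|/psi1 p1].
    by move=> /(congr1 (fun i => 1 - i)); rewrite subKr => -[/upsilon_eq0].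
  by move=> /(canRL (addKr _)); rewrite opprK => -[p2]; rewrite p2 in p1.
- have := mu_to_ideal b (max_to_filter_min sy).
  rewrite to_filterK; last by case: sy.
  by move=> ->; rewrite opprD addrNK.
Qed.

End Mu.

(** * Existence of minuscule representations *)

Theorem theorem10p1 (R : realType) (G : sgraph) (d : Order.disp_t)
  (P : porderType d) (kappa : P -> G)
  (locfin : locally_finite_poset P)
  (kappa_surj : forall a : G, exists x : P, kappa x = a) :
  ((exists H, upper_minuscule (R := R) kappa H) <->
     [/\ prop_EC kappa, prop_NA kappa, prop_AC kappa, prop_I2A kappa
       & prop_Mx1GA kappa]) /\
  ((exists H, lower_minuscule (R := R) kappa H) <->
     [/\ prop_EC kappa, prop_NA kappa, prop_AC kappa, prop_I2A kappa
       & prop_Mn1LA kappa]) /\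
  ([/\ prop_EC kappa, prop_NA kappa, prop_AC kappa, prop_I2A kappa
     & prop_Mx1GA kappa] ->
     upper_minuscule kappa (mu_op kappa R)) /\
  ([/\ prop_EC kappa, prop_NA kappa, prop_AC kappa, prop_I2A kappa
     & prop_Mn1LA kappa] ->
     lower_minuscule kappa (mu_op kappa R)).
Proof.
have upper : [/\ prop_EC kappa, prop_NA kappa, prop_AC kappa, prop_I2A kappa
    & prop_Mx1GA kappa] -> upper_minuscule kappa (mu_op kappa R).
  move=> [EC NA AC I2A Mx].
  apply: weight_upper_minuscule.
    exact: mu_upper_weight locfin kappa_surj EC NA AC I2A Mx.
  by move=> a s; exact: linext_ket.
have lower : [/\ prop_EC kappa, prop_NA kappa, prop_AC kappa, prop_I2A kappa
    & prop_Mn1LA kappa] -> lower_minuscule kappa (mu_op kappa R).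
  move=> [EC NA AC I2A Mn].
  apply: weight_lower_minuscule.
    exact: mu_lower_weight locfin kappa_surj EC NA AC I2A Mn.
  by move=> a s; rewrite (opprK (mu kappa a s)); exact: linext_ket.
split; last split; last by split; [exact: upper|exact: lower].
  split=> [[H /upper_minuscule_weight[c cP]]|/upper]; last by exists (mu_op kappa R).
  exact: upper_weight_properties locfin cP.
split=> [[H /lower_minuscule_weight[c cP]]|/lower]; last by exists (mu_op kappa R).
exact: lower_weight_properties locfin cP.
Qed.
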